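(* Let $0<q_1<1$ and $0<q_2<1$, let $u,v:[0,\infty)\to[0,\infty)$ be continuous synchronous functions, let $\lambda\in\mathbb{R}$, and let $f,g,h\in C_\lambda$ be synchronous on $[0,\infty)$ and such that there are constants $\phi,\psi,\omega,\Phi,\Psi,\Omega\in\mathbb{R}$ with $$\psi\le f(x)\le\Psi,\qquad \phi\le g(x)\le\Phi,\qquad \omega\le h(x)\le\Omega\qquad\text{for all }x\in[0,\infty).$$ Then the following inequality holds for all $t>0$, all $\mu,\nu,\beta,\delta>0$ and all $\eta,\zeta\in\mathbb{C}$: $$ \begin{aligned} \Bigl|\, & I^{\eta,\mu,\beta}_{q_1}\{u(t)f(t)g(t)h(t)\}\,I^{\zeta,\nu,\delta}_{q_2}\{v(t)\}+I^{\eta,\mu,\beta}_{q_1}\{u(t)h(t)\}\,I^{\zeta,\nu,\delta}_{q_2}\{v(t)f(t)g(t)\}\\ &+I^{\eta,\mu,\beta}_{q_1}\{u(t)g(t)\}\,I^{\zeta,\nu,\delta}_{q_2}\{v(t)f(t)h(t)\}+I^{\eta,\mu,\beta}_{q_1}\{u(t)f(t)\}\,I^{\zeta,\nu,\delta}_{q_2}\{v(t)g(t)h(t)\}\\ &-I^{\eta,\mu,\beta}_{q_1}\{u(t)g(t)h(t)\}\,I^{\zeta,\nu,\delta}_{q_2}\{v(t)f(t)\}-I^{\eta,\mu,\beta}_{q_1}\{u(t)f(t)h(t)\}\,I^{\zeta,\nu,\delta}_{q_2}\{v(t)g(t)\}\\ &-I^{\eta,\mu,\beta}_{q_1}\{u(t)f(t)g(t)\}\,I^{\zeta,\nu,\delta}_{q_2}\{v(t)h(t)\}-I^{\eta,\mu,\beta}_{q_1}\{u(t)\}\,I^{\zeta,\nu,\delta}_{q_2}\{v(t)f(t)g(t)h(t)\}\Bigr|\\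 &\le I^{\eta,\mu,\beta}_{q_1}\{u(t)\}\,I^{\zeta,\nu,\delta}_{q_2}\{v(t)\}\,(\Psi-\psi)(\Phi-\phi)(\Omega-\omega). \end{aligned} $$
   Context: Two real functions $f,g$ are synchronous on an interval $I$ if $(f(x)-f(y))(g(x)-g(y))\ge 0$ for all $x,y\in I$; three functions are called synchronous if any two of them are. A real-valued function $f(t)$ ($t>0$) belongs to $C_\lambda$ ($\lambda\in\mathbb{R}$) if there is a real number $p>\lambda$ such that $f(t)=t^p\varphi(t)$ with $\varphi\in C(0,\infty)$. For $0<q<1$ the $q$-shifted factorial is $(a;q)_0=1$ and $(a;q)_k=\prod_{j=0}^{k-1}(1-aq^j)$ for $k\ge1$. For $\Re(\beta),\Re(\mu)>0$ and $\eta\in\mathbb{C}$, the generalized Erdélyi-Kober fractional $q$-integral operator is $$I^{\eta,\mu,\beta}_q\{f(t)\}=\beta\,(1-q^{1/\beta})(1-q)^{\mu-1}\sum_{k=0}^\infty\frac{(q^\mu;q)_k}{(q;q)_k}\,q^{k(\eta+1)}f\bigl(tq^{k/\beta}\bigr),\qquad t>0.$$ The notation $I^{\eta,\mu,\beta}_q\{F(t)\}$ means the operator applied to the function $F$ and evaluated at $t$.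
   Formalization: The series for I{u(t)} and I{v(t)} are assumed to converge absolutely (they diverge e.g. for u=1, η=-2); the stated inequality is asserted for real η, ζ, and for complex η, ζ the right side, otherwise possibly non-real, uses Re η, Re ζ instead. *)

(* Defs.v *)
(* MathComp-Analysis; complex numbers are R[i] from mathcomp-real-closed. *)
From HB Require Import structures.
From mathcomp Require Import all_boot all_order all_algebra.
From mathcomp Require Import complex.
From mathcomp Require Import all_classical all_reals all_analysis.

Set Implicit Arguments.
Unset Strict Implicit.
Unset Printing Implicit Defensive.

Import Order.TTheory GRing.Theory Num.Theory.
Import numFieldNormedType.Exports.

Local Open Scope classical_set_scope.
Local Open Scope ring_scope.
Local Open Scope complex_scope.

Definition synchronous (R : realType) (I : set R) (f g : R -> R) : Prop :=
  forall x y : R, I x -> I y -> 0 <= (f x - f y) * (g x - g y).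

Definition synchronous3 (R : realType) (I : set R) (f g h : R -> R) : Prop :=
  [/\ synchronous I f g, synchronous I f h & synchronous I g h].

(* The space C_lambda; it only constrains f on the open half-line. *)
Definition Cspace (R : realType) (lambda : R) (f : R -> R) : Prop :=
  exists (p : R) (phi : R -> R),
    [/\ lambda < p,
        {within [set` `]0, +oo[], continuous phi} &
        forall t : R, 0 < t -> f t = t `^ p * phi t].

Definition qpochhammer (R : realType) (a q : R) (k : nat) : R :=
  \prod_(j < k) (1 - a * q ^+ j).

(* a ^ z := exp (z ln a), for a real base a > 0 and a complex exponent z. *)
Definition cpower (R : realType) (a : R) (z : R[i]) : R[i] :=
  (expR (complex.Re z * ln a))%:C *
  (cos (complex.Im z * ln a) +i* sin (complex.Im z * ln a)).

(* The modulus as an element of R; `|z| itself lives in R[i]. *)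
Definition cmod (R : realType) (z : R[i]) : R := complex.Re `|z|.

(* R[i] carries no topology in the library, hence the componentwise limits;
   the value is meaningful only for convergent series. *)
Definition csum (R : realType) (a : nat -> R[i]) : R[i] :=
  limn (series (fun k => complex.Re (a k))) +i*
  limn (series (fun k => complex.Im (a k))).

Definition EK_term (R : realType) (q : R) (eta : R[i]) (mu beta : R)
    (F : R -> R) (t : R) (k : nat) : R[i] :=
  (qpochhammer (q `^ mu) q k / qpochhammer q q k)%:C *
  cpower q (k%:R * (eta + 1)) *
  (F (t * q `^ (k%:R / beta)))%:C.

(* The generalized Erdelyi-Kober fractional q-integral of F at t. *)
Definition EK (R : realType) (q : R) (eta : R[i]) (mu beta : R)
    (F : R -> R) (t : R) : R[i] :=
  (beta * (1 - q `^ (1 / beta)) * (1 - q) `^ (mu - 1))%:C *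
  csum (EK_term q eta mu beta F t).

(* Absolute convergence of the defining series. For u >= 0 on the half-line and
   real eta the terms are nonnegative, so this is plain convergence; for u
   continuous on [0, +oo[ it holds as soon as Re eta > -1. *)
Definition EK_exists (R : realType) (q : R) (eta : R[i]) (mu beta : R)
    (F : R -> R) (t : R) : Prop :=
  cvgn (series (fun k => cmod (EK_term q eta mu beta F t k))).

(* Main.v *)
Require Import Defs.
From HB Require Import structures.
From mathcomp Require Import all_boot all_order all_algebra.
From mathcomp Require Import complex ring.
From mathcomp Require Import all_classical all_reals all_analysis.

Set Implicit Arguments.
Unset Strict Implicit.
Unset Printing Implicit Defensive.

Import Order.TTheory GRing.Theory Num.Theory.
Import numFieldNormedType.Exports.

Local Open Scope classical_set_scope.
Local Open Scope ring_scope.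
Local Open Scope complex_scope.

(** Write [w_k], [w'_l] for the complex weights and [x_k], [y_l] for the nodes
    of the two operators.  After expanding
      [(f x_k - f y_l) (g x_k - g y_l) (h x_k - h y_l)]
    the eight products inside the modulus are exactly the double series of
      [w_k u(x_k) w'_l v(y_l)]
    times this triple difference.  Since [f], [g], [h] take values in
    [[psi, Psi]], [[phi, Phi]], [[omega, Omega]], the triple difference is at
    most [(Psi - psi) (Phi - phi) (Omega - omega)] in absolute value, so the
    triangle inequality leaves the product of the series of [|w_k| u(x_k)] and
    [|w'_l| v(y_l)].  The modulus of [q ^ (k (eta + 1))] only depends on the
    real part of [eta], and all other factors of the weight are nonnegative;
    hence [|w_k|] is the weight attached to [Re eta] ([norm_EK_weight]) and
    these two series are the operators with parameters [Re eta], [Re zeta]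
    applied to [u], [v].

    The algebra ([sum_triple_difference]) and the estimate
    ([norm_weighted_sum_le]) are carried out on square partial sums, which
    avoids double series.  Every series involved converges absolutely by
    comparison with that of [u] or [v], because [f], [g], [h] are bounded
    ([EK_cvg]), and the inequality passes to the limit ([cvgC_norm_le]).
    When [eta] and [zeta] are real they equal their real parts, which gives the
    first half of the statement from the second. *)

(** * Componentwise limits of complex sequences *)

(** Convergence of a complex sequence, as convergence of its real and imaginary
    parts: the notion of limit underlying [csum]. *)
Definition cvgC (R : realType) (z : nat -> R[i]) (l : R[i]) : Prop :=
  (fun n => complex.Re (z n)) @ \oo --> complex.Re l /\
  (fun n => complex.Im (z n)) @ \oo --> complex.Im l.

Section ComplexLimits.
Variable R : realType.
Implicit Types (z w : nat -> R[i]) (l m c : R[i]).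

Lemma cvgC_cst c : cvgC (fun _ => c) c.
Proof. by split; exact: cvg_cst. Qed.

Lemma cvgCD z w l m : cvgC z l -> cvgC w m -> cvgC (fun n => z n + w n) (l + m).
Proof.
move=> [zr zi] [wr wi]; case: l m zr zi wr wi => [a b] [c d] /= zr zi wr wi.
split => /=.
  under eq_fun => n do (rewrite (_ : complex.Re _ =
    complex.Re (z n) + complex.Re (w n)); last
    by case: (z n) (w n) => [? ?] [? ?]).
  exact: cvgD zr wr.
under eq_fun => n do (rewrite (_ : complex.Im _ =
  complex.Im (z n) + complex.Im (w n)); last
  by case: (z n) (w n) => [? ?] [? ?]).
exact: cvgD zi wi.
Qed.

Lemma cvgCN z l : cvgC z l -> cvgC (fun n => - z n) (- l).
Proof.
case: l => a b [/= zr zi]; split => /=.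
  under eq_fun => n do (rewrite (_ : complex.Re _ = - complex.Re (z n));
    last by case: (z n)).
  exact: cvgN zr.
under eq_fun => n do (rewrite (_ : complex.Im _ = - complex.Im (z n));
  last by case: (z n)).
exact: cvgN zi.
Qed.

Lemma cvgCB z w l m : cvgC z l -> cvgC w m -> cvgC (fun n => z n - w n) (l - m).
Proof. by move=> zl /cvgCN; exact: cvgCD. Qed.

Lemma cvgCM z w l m : cvgC z l -> cvgC w m -> cvgC (fun n => z n * w n) (l * m).
Proof.
move=> [zr zi] [wr wi]; case: l m zr zi wr wi => [a b] [c d] /= zr zi wr wi.
split => /=.
  under eq_fun => n do (rewrite (_ : complex.Re _ =
    complex.Re (z n) * complex.Re (w n) - complex.Im (z n) * complex.Im (w n));
    last by case: (z n) (w n) => [? ?] [? ?]).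
  by apply: cvgB; exact: cvgM.
under eq_fun => n do (rewrite (_ : complex.Im _ =
  complex.Re (z n) * complex.Im (w n) + complex.Im (z n) * complex.Re (w n));
  last by case: (z n) (w n) => [? ?] [? ?]).
by apply: cvgD; exact: cvgM.
Qed.

(** Bounds on the modulus pass to the limit.  The order of [R[i]] only compares
    numbers with equal imaginary parts, so the hypothesis forces [w], and hence
    [m], to be real. *)
Lemma cvgC_norm_le z w l m : cvgC z l -> cvgC w m ->
  (forall n, `|z n| <= w n) -> `|l| <= m.
Proof.
move=> [zr zi] [wr wi] zw.
have wi0 n : complex.Im (w n) = 0.
  by move: (zw n); rewrite normc_def lecE /= => /andP[/eqP].
have zwr n : Num.sqrt (complex.Re (z n) ^+ 2 + complex.Im (z n) ^+ 2)
    <= complex.Re (w n).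
  by move: (zw n); rewrite normc_def lecE /= => /andP[].
rewrite normc_def lecE /=; apply/andP; split.
  apply/eqP; apply: (cvg_unique _ wi) => //.
  by rewrite (_ : (fun _ => _) = fun=> 0); [exact: cvg_cst | exact/funext].
have zn : (fun n => Num.sqrt (complex.Re (z n) ^+ 2 + complex.Im (z n) ^+ 2))
    @ \oo --> Num.sqrt (complex.Re l ^+ 2 + complex.Im l ^+ 2).
  apply: continuous_cvg; first exact: sqrt_continuous.
  by rewrite !expr2; under eq_fun do rewrite !expr2; apply: cvgD; exact: cvgM.
exact: ler_cvg_to zn wr (nearW _ zwr).
Qed.

Lemma Re_sum (a : nat -> R[i]) n :
  complex.Re (\sum_(0 <= k < n) a k) = \sum_(0 <= k < n) complex.Re (a k).
Proof. by apply: (big_morph (@complex.Re R)) => // -[? ?] [? ?]. Qed.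

Lemma Im_sum (a : nat -> R[i]) n :
  complex.Im (\sum_(0 <= k < n) a k) = \sum_(0 <= k < n) complex.Im (a k).
Proof. by apply: (big_morph (@complex.Im R)) => // -[? ?] [? ?]. Qed.

Lemma cmodE c : (cmod c)%:C = `|c|.
Proof. by rewrite /cmod normc_def. Qed.

Lemma cmodM c l : cmod (c * l) = cmod c * cmod l.
Proof. by apply: complexI; rewrite rmorphM /= !cmodE normrM. Qed.

Lemma cmod_ge0 c : 0 <= cmod c.
Proof. by rewrite -ler0c cmodE. Qed.

Lemma cmod_real (x : R) : cmod x%:C = `|x|.
Proof. by rewrite /cmod normc_def /= expr0n addr0 sqrtr_sqr. Qed.

Lemma norm_Re_le_cmod c : `|complex.Re c| <= cmod c.
Proof. by rewrite -lecR cmodE normc_ge_Re. Qed.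

Lemma norm_Im_le_cmod c : `|complex.Im c| <= cmod c.
Proof.
rewrite /cmod normc_def /= -sqrtr_sqr ler_wsqrtr// lerDr; exact: sqr_ge0.
Qed.

(** An absolutely convergent complex series converges to [csum]. *)
Lemma csum_cvgC (a : nat -> R[i]) :
  cvgn (series (fun k => cmod (a k))) ->
  cvgC (fun n => \sum_(0 <= k < n) a k) (csum a).
Proof.
move=> ca; split => /=.
- under eq_fun do rewrite Re_sum.
  apply: (normed_cvg _ : cvgn (series (fun k => complex.Re (a k)))).
  apply: series_le_cvg ca => k //=; first exact: cmod_ge0.
  exact: norm_Re_le_cmod.
- under eq_fun do rewrite Im_sum.
  apply: (normed_cvg _ : cvgn (series (fun k => complex.Im (a k)))).
  apply: series_le_cvg ca => k //=; first exact: cmod_ge0.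
  exact: norm_Im_le_cmod.
Qed.

End ComplexLimits.

(** * Complex powers, weights and nodes of the q-integral *)

(** For a real base the modulus of a complex power only sees the real part of
    the exponent. *)
Lemma norm_cpower (R : realType) (a : R) (z : R[i]) :
  `|cpower a z| = cpower a (complex.Re z)%:C.
Proof.
rewrite /cpower normrM -!cmodE cmod_real /= mul0r cos0 sin0 mulr1.
rewrite ger0_norm ?expR_ge0// /cmod normc_def /=.
by rewrite cos2Dsin2 sqrtr1 mulr1.
Qed.

Lemma qpochhammer_ge0 (R : realType) (a q : R) (k : nat) :
  0 <= a <= 1 -> 0 <= q <= 1 -> 0 <= qpochhammer a q k.
Proof.
move=> /andP[a0 a1] /andP[q0 q1]; apply: prodr_ge0 => j _.
by rewrite subr_ge0 mulr_ile1// ?exprn_ge0// exprn_ile1.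
Qed.

Lemma Re_nat_mul (R : realType) (k : nat) (z : R[i]) :
  complex.Re (k%:R * z) = k%:R * complex.Re z.
Proof.
rewrite !mulr_natl; elim: k => // k ih; rewrite !mulrS -ih.
by case: z (z *+ k) {ih} => [? ?] [? ?].
Qed.

(** The coefficient of [F (EK_node q beta t k)] in the operator [EK], with the
    prefactor of the series included. *)
Definition EK_weight (R : realType) (q : R) (eta : R[i]) (mu beta : R)
    (k : nat) : R[i] :=
  (beta * (1 - q `^ (1 / beta)) * (1 - q) `^ (mu - 1))%:C *
  ((qpochhammer (q `^ mu) q k / qpochhammer q q k)%:C *
   cpower q (k%:R * (eta + 1))).

(** The k-th point at which [EK] evaluates its argument. *)
Definition EK_node (R : realType) (q beta t : R) (k : nat) : R :=
  t * q `^ (k%:R / beta).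

(** * Moduli of the weights and convergence of the q-integral *)

(** On the closed half-line, [|F|] is at most a constant multiple of [|u|]. *)
Definition dominated (R : realType) (u F : R -> R) : Prop :=
  exists K : R, forall x : R, 0 <= x -> `|F x| <= K * `|u x|.

Lemma dominated_refl (R : realType) (u : R -> R) : dominated u u.
Proof. by exists 1 => x _; rewrite mul1r. Qed.

Lemma dominatedM (R : realType) (u F f : R -> R) (a b : R) :
  dominated u F -> (forall x : R, 0 <= x -> a <= f x <= b) ->
  dominated u (fun x => F x * f x).
Proof.
move=> [K FK] fab; exists (K * (`|a| + `|b|)) => x x0.
rewrite normrM mulrAC ler_pM ?FK//; have /andP[af fb] := fab _ x0.
rewrite ler_norml; apply/andP; split.
  rewrite (le_trans _ af)// opprD ler_wnDr ?oppr_le0//.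
  by rewrite lerNl -normrN ler_norm.
by rewrite (le_trans fb)// ler_wpDl// ler_norm.
Qed.

Section ErdelyiKober.
Variables (R : realType) (q mu beta t : R).
Hypotheses (hq : 0 < q < 1) (hmu : 0 < mu) (hbeta : 0 < beta) (ht : 0 < t).
Implicit Types (eta : R[i]) (F u : R -> R).

Let q0 : 0 <= q. Proof. by case/andP: hq => /ltW. Qed.
Let q1 : q <= 1. Proof. by case/andP: hq => _ /ltW. Qed.

Lemma powR_base_le1 (p : R) : 0 <= p -> q `^ p <= 1.
Proof.
move=> p0; rewrite (_ : 1 = 1 `^ p); last by rewrite powR1.
by apply: ge0_ler_powR => //; rewrite nnegrE ?ler01.
Qed.

Lemma EK_node_ge0 k : 0 <= EK_node q beta t k.
Proof. by rewrite mulr_ge0 ?powR_ge0 ?ltW. Qed.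

(** The coefficients for a real parameter are the moduli of those for any
    complex parameter with that real part. *)
Lemma norm_EK_weight eta k :
  `|EK_weight q eta mu beta k| = EK_weight q (complex.Re eta)%:C mu beta k.
Proof.
rewrite /EK_weight [LHS]normrM [`|_ * cpower _ _|]normrM norm_cpower.
rewrite -!cmodE !cmod_real !ger0_norm.
- congr (_ * (_ * cpower _ _)); rewrite Re_nat_mul rmorphM rmorph_nat.
  by case: eta => a b /=; rewrite rmorphD rmorph1.
- by rewrite divr_ge0// qpochhammer_ge0 ?q0 ?q1 ?powR_ge0 ?powR_base_le1 ?ltW.
- rewrite !mulr_ge0 ?powR_ge0 ?subr_ge0 ?(ltW hbeta)//.
  by rewrite powR_base_le1// divr_ge0// ltW.
Qed.

(** Absolute convergence for [u] makes the partial sums converge to the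
    operator, for every function dominated by [u]. *)
Lemma EK_cvg eta u F :
  EK_exists q eta mu beta u t -> dominated u F ->
  cvgC (fun n => \sum_(0 <= k < n)
          EK_weight q eta mu beta k * (F (EK_node q beta t k))%:C)
       (EK q eta mu beta F t).
Proof.
move=> cu [K FK].
have cF : EK_exists q eta mu beta F t.
  have le_term k : cmod (EK_term q eta mu beta F t k) <=
      K * cmod (EK_term q eta mu beta u t k).
    rewrite [leLHS]cmodM [in leRHS]cmodM [leRHS]mulrCA !cmod_real.
    by rewrite ler_wpM2l ?cmod_ge0// FK ?EK_node_ge0.
  apply: (series_le_cvg _ _ le_term (@is_cvg_seriesZ _ _ K cu)) => k.
    exact: cmod_ge0.
  exact: le_trans (cmod_ge0 _) (le_term k).
rewrite (_ : (fun n => _) = fun n =>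
    (beta * (1 - q `^ (1 / beta)) * (1 - q) `^ (mu - 1))%:C *
    \sum_(0 <= k < n) EK_term q eta mu beta F t k).
  exact: cvgCM (cvgC_cst _) (csum_cvgC cF).
apply/funext => n; rewrite mulr_sumr; apply: eq_bigr => k _.
by rewrite /EK_weight -mulrA.
Qed.

Lemma EK_exists_Re eta u :
  EK_exists q eta mu beta u t ->
  EK_exists q (complex.Re eta)%:C mu beta u t.
Proof.
rewrite /EK_exists => cu.
suff -> : (fun k => cmod (EK_term q (complex.Re eta)%:C mu beta u t k)) =
    (fun k => cmod (EK_term q eta mu beta u t k)) by [].
apply/funext => k; rewrite /EK_term [LHS]cmodM [RHS]cmodM; congr (_ * _).
rewrite [LHS]cmodM [RHS]cmodM; congr (_ * _); apply: complexI.
by rewrite !cmodE !norm_cpower !Re_nat_mul; case: (eta).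
Qed.

End ErdelyiKober.

(** * The inequality on partial sums *)

(** The combination of eight products, written as one double sum of triple
    differences. *)
Lemma sum_triple_difference (R : realType) (r : seq nat) (a b : nat -> R[i])
    (x y : nat -> R) (u v f g h : R -> R) :
  let A F := \sum_(k <- r) a k * (F (x k))%:C in
  let B F := \sum_(k <- r) b k * (F (y k))%:C in
  A (fun x => u x * f x * g x * h x) * B v
  + A (fun x => u x * h x) * B (fun x => v x * f x * g x)
  + A (fun x => u x * g x) * B (fun x => v x * f x * h x)
  + A (fun x => u x * f x) * B (fun x => v x * g x * h x)
  - A (fun x => u x * g x * h x) * B (fun x => v x * f x)
  - A (fun x => u x * f x * h x) * B (fun x => v x * g x)
  - A (fun x => u x * f x * g x) * B (fun x => v x * h x)
  - A u * B (fun x => v x * f x * g x * h x)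
  = \sum_(k <- r) \sum_(l <- r) (a k * (u (x k))%:C) * (b l * (v (y l))%:C) *
      ((f (x k) - f (y l)) * (g (x k) - g (y l)) * (h (x k) - h (y l)))%:C.
Proof.
rewrite /= !big_distrlr /= -!big_split -!sumrB /=; apply: eq_bigr => k _.
rewrite -!big_split -!sumrB /=; apply: eq_bigr => l _.
by rewrite !rmorphM !rmorphB /=; ring.
Qed.

Lemma norm_weighted_sum_le (R : realType) (r : seq nat) (a b : nat -> R[i])
    (c : nat -> nat -> R) (M : R) :
  (forall k l, `|c k l| <= M) ->
  `|\sum_(k <- r) \sum_(l <- r) a k * b l * (c k l)%:C|
    <= (\sum_(k <- r) `|a k|) * (\sum_(l <- r) `|b l|) * M%:C.
Proof.
move=> cM; rewrite big_distrlr mulr_suml.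
apply: le_trans (ler_norm_sum _ _ _) _; apply: ler_sum => k _.
rewrite mulr_suml.
apply: le_trans (ler_norm_sum _ _ _) _; apply: ler_sum => l _.
rewrite !normrM ler_wpM2l ?mulr_ge0//.
by rewrite -cmodE cmod_real lecR.
Qed.

Lemma norm_diff_le (R : realType) (a b x y : R) :
  a <= x <= b -> a <= y <= b -> `|x - y| <= b - a.
Proof.
move=> /andP[ax xb] /andP[ay yb]; rewrite ler_norml opprB.
by rewrite !lerB.
Qed.

(** * The inequality for the q-integrals *)

Theorem theorem4 (R : realType) (q1 q2 : R)
    (hq1 : 0 < q1 < 1) (hq2 : 0 < q2 < 1)
    (u v : R -> R)
    (hu0 : forall x : R, 0 <= x -> 0 <= u x)
    (hv0 : forall x : R, 0 <= x -> 0 <= v x)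
    (huc : {within [set` `[0, +oo[], continuous u})
    (hvc : {within [set` `[0, +oo[], continuous v})
    (huv : synchronous [set` `[0, +oo[] u v)
    (lambda : R) (f g h : R -> R)
    (hf : Cspace lambda f) (hg : Cspace lambda g) (hh : Cspace lambda h)
    (hfgh : synchronous3 [set` `[0, +oo[] f g h)
    (phi psi omega Phi Psi Omega : R)
    (hfb : forall x : R, 0 <= x -> psi <= f x <= Psi)
    (hgb : forall x : R, 0 <= x -> phi <= g x <= Phi)
    (hhb : forall x : R, 0 <= x -> omega <= h x <= Omega)
    (t mu nu beta delta : R)
    (ht : 0 < t) (hmu : 0 < mu) (hnu : 0 < nu)
    (hbeta : 0 < beta) (hdelta : 0 < delta)
    (eta zeta : R[i])
    (hIu : EK_exists q1 eta mu beta u t)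
    (hIv : EK_exists q2 zeta nu delta v t) :
  let I1 (e : R[i]) (F : R -> R) : R[i] := EK q1 e mu beta F t in
  let I2 (z : R[i]) (F : R -> R) : R[i] := EK q2 z nu delta F t in
  let lhs : R[i] :=
    `| I1 eta (fun x => u x * f x * g x * h x) * I2 zeta v
     + I1 eta (fun x => u x * h x) * I2 zeta (fun x => v x * f x * g x)
     + I1 eta (fun x => u x * g x) * I2 zeta (fun x => v x * f x * h x)
     + I1 eta (fun x => u x * f x) * I2 zeta (fun x => v x * g x * h x)
     - I1 eta (fun x => u x * g x * h x) * I2 zeta (fun x => v x * f x)
     - I1 eta (fun x => u x * f x * h x) * I2 zeta (fun x => v x * g x)
     - I1 eta (fun x => u x * f x * g x) * I2 zeta (fun x => v x * h x)
     - I1 eta u * I2 zeta (fun x => v x * f x * g x * h x) | in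
  let bound : R[i] := ((Psi - psi) * (Phi - phi) * (Omega - omega))%:C in
  (complex.Im eta = 0 -> complex.Im zeta = 0 ->
     lhs <= I1 eta u * I2 zeta v * bound) /\
  lhs <= I1 (complex.Re eta)%:C u * I2 (complex.Re zeta)%:C v * bound.
Proof.
move=> I1 I2 lhs bound.
have key : lhs <= I1 (complex.Re eta)%:C u * I2 (complex.Re zeta)%:C v * bound.
  have cA F : dominated u F -> _ := EK_cvg ht hIu.
  have cB F : dominated v F -> _ := EK_cvg ht hIv.
  have du := dominated_refl u.
  have dv := dominated_refl v.
  have cu := EK_cvg ht (EK_exists_Re hIu) du.
  have cv := EK_cvg ht (EK_exists_Re hIv) dv.
  have [[duf dug] duh] :=
    (dominatedM du hfb, dominatedM du hgb, dominatedM du hhb).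
  have [[dvf dvg] dvh] :=
    (dominatedM dv hfb, dominatedM dv hgb, dominatedM dv hhb).
  have [[dufg dufh] dugh] :=
    (dominatedM duf hgb, dominatedM duf hhb, dominatedM dug hhb).
  have [[dvfg dvfh] dvgh] :=
    (dominatedM dvf hgb, dominatedM dvf hhb, dominatedM dvg hhb).
  have [dufgh dvfgh] := (dominatedM dufg hhb, dominatedM dvfg hhb).
  apply: (cvgC_norm_le _ (cvgCM (cvgCM cu cv) (cvgC_cst bound))).
    apply: cvgCB; last by apply: cvgCM; [exact: cA | exact: cB].
    apply: cvgCB; last by apply: cvgCM; [exact: cA | exact: cB].
    apply: cvgCB; last by apply: cvgCM; [exact: cA | exact: cB].
    apply: cvgCB; last by apply: cvgCM; [exact: cA | exact: cB].
    apply: cvgCD; last by apply: cvgCM; [exact: cA | exact: cB].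
    apply: cvgCD; last by apply: cvgCM; [exact: cA | exact: cB].
    by apply: cvgCD;
      apply: cvgCM; [exact: cA | exact: cB | exact: cA | exact: cB].
  move=> n /=; rewrite sum_triple_difference.
  apply: le_trans (norm_weighted_sum_le _ _ _
    (M := (Psi - psi) * (Phi - phi) * (Omega - omega)) _) _.
    move=> k l; rewrite !normrM !ler_pM ?mulr_ge0//; apply: norm_diff_le;
      by (apply: hfb || apply: hgb || apply: hhb); exact: EK_node_ge0.
  (* Both sides agree: the moduli of the terms are the terms for the real parts
     of the parameters. *)
  rewrite le_eqVlt; apply/orP; left; apply/eqP.
  congr (_ * _ * _); apply: eq_bigr => k _; rewrite normrM norm_EK_weight//;
    by rewrite -cmodE cmod_real ger0_norm// (hu0, hv0) ?EK_node_ge0.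
split => // eta0 zeta0.
have real_eq (z : R[i]) : complex.Im z = 0 -> (complex.Re z)%:C = z.
  by case: z => x y /= ->.
by move: key; rewrite !real_eq.
Qed.
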